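(* Let $k,n>1$ be integers and let $P$ be a $\sigma_n$-$k$-partition with defining sequence $a_1,\ldots,a_{\lfloor n/2\rfloor}$. Assume $a_1=0$ and let $i$ be an index with $1\le i<\lfloor n/2\rfloor$ such that $a_j\ne k-1$ for $1\le j\le i$. If $P$ has a transitive $\sigma_n$-orientation, then $a_{i+1}\le a_i+1$ (as an inequality between integers in $\{0,\dots,k\}$).
   Context: $K_n$ is the complete graph on the vertex set $[n]=\{0,1,\dots,n-1\}$; vertices are considered as residue classes modulo $n$, and $\sigma_n$ is the cyclic permutation of $[n]$ with $\sigma_n(i)=i+1$ (mod $n$), acting also on edges, graphs and digraphs. A $\sigma_n$-$k$-partition is a partition of the edge set of $K_n$ into subgraphs $F_0,\dots,F_{k-1}$ with $\sigma_n(F_d)=F_{d+1}$ for $0\le d<k-1$. (This forces $k\mid n$, and $2k\mid n$ if $k$ is even; also $\sigma_n(F_{k-1})=F_0$.) The label of an edge $e\in F_d$ is $\ell(e)=d$. The defining sequence of the partition is $a_1,\dots,a_{\lfloor n/2\rfloor}$ with $a_i=\ell(\{0,i\})\in\{0,\dots,k-1\}$. A transitive orientation $T$ of $K_n$ (i.e. a transitive tournament on $[n]$) is a transitive $\sigma_n$-orientation of the $\sigma_n$-$k$-partition if $\sigma_n(\vec F_d)=\vec F_{d+1}$ for $0\le d<k-1$, where $\vec F_d$ is the orientation of $F_d$ obtained as a subgraph of $T$. *)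

(* Defs.v *)
From mathcomp Require Import all_boot.
Set Implicit Arguments.
Unset Strict Implicit.
Unset Printing Implicit Defensive.

(* Edges are two-element sets of vertices, digraphs are sets of ordered pairs;
   [ordS] is the cyclic successor i |-> i + 1 (mod n) on 'I_n. *)
Definition complete_graph (n : nat) : {set {set 'I_n}} :=
  [set e : {set 'I_n} | #|e| == 2].

Definition sigma_graph (n : nat) (F : {set {set 'I_n}}) : {set {set 'I_n}} :=
  [set [set ordS x | x in e] | e : {set 'I_n} in F].

Definition sigma_digraph (n : nat) (A : {set 'I_n * 'I_n}) :
    {set 'I_n * 'I_n} :=
  [set (ordS p.1, ordS p.2) | p in A].

(* Injectivity of F makes the blocks F d pairwise distinct, since [partition]
   only sees the set of blocks. *)
Definition sigma_partition (n k : nat) (F : 'I_k -> {set {set 'I_n}}) : Prop :=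
  [/\ injective F,
      partition [set F d | d : 'I_k] (complete_graph n)
    & forall d d' : 'I_k, d' = d.+1 :> nat -> sigma_graph (F d) = F d'].

(* The default value k is taken only when e belongs to no F d. *)
Definition label (n k : nat) (F : 'I_k -> {set {set 'I_n}}) (e : {set 'I_n}) :
    nat :=
  if [pick d | e \in F d] is Some d then val d else k.

(* The set below is the edge {0, i} of the complete graph for 0 < i < n; the
   value is meaningful for 1 <= i <= n./2. *)
Definition defining_sequence (n k : nat) (F : 'I_k -> {set {set 'I_n}})
    (i : nat) : nat :=
  label F [set x : 'I_n | val x \in [:: 0; i]].

Definition transitive_tournament (n : nat) (T : {set 'I_n * 'I_n}) : Prop :=
  [/\ forall x, (x, x) \notin T,
      forall x y, x != y -> ((x, y) \in T) (+) ((y, x) \in T)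
    & forall x y z, (x, y) \in T -> (y, z) \in T -> (x, z) \in T].

Definition oriented_subgraph (n : nat) (T : {set 'I_n * 'I_n})
    (F : {set {set 'I_n}}) : {set 'I_n * 'I_n} :=
  [set p in T | [set p.1; p.2] \in F].

Definition transitive_sigma_orientation (n k : nat)
    (F : 'I_k -> {set {set 'I_n}}) (T : {set 'I_n * 'I_n}) : Prop :=
  transitive_tournament T /\
  forall d d' : 'I_k, d' = d.+1 :> nat ->
    sigma_digraph (oriented_subgraph T (F d)) = oriented_subgraph T (F d').

(* Main.v *)
Require Import Defs.
From mathcomp Require Import all_boot.
From mathcomp Require Import zify.

Set Implicit Arguments.
Unset Strict Implicit.
Unset Printing Implicit Defensive.

(** Write [x -> y] when the arc from [x] to [y] lies in the orientation, the
    integers [x], [y] being read modulo [n], and call the truth value of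
    [x -> x + j] the sign of the [j]-edge at [x].  Its label is [a_j + x]
    modulo [k], and its sign is unchanged when [x] increases by one, unless the
    label wraps from [k - 1] to 0.  So the sign of [j]-edges is constant on
    each of the intervals [mk - a_j, mk + k - 1 - a_j].

    Let [e_m] be the sign of the 1-edge at [mk].  For [j <= i] the hypothesis
    [a_j <> k - 1] says that the [j]-edges at [mk] and [mk + 1] have the same
    sign, so transitivity along [mk], [mk + 1], [mk + 1 + j] shows by induction
    that all [j]-edges at [mk] with [j <= i + 1] have sign [e_m]
    ([sign_block_start]).

    Suppose [a_(i+1) >= a_i + 2] and put [z = (m + 1)k - a_i - 2].  The 1-edge
    at [z] and the [i]-edge at [z + 1] still have sign [e_m], whereas the
    [(i+1)]-edge at [z] already has sign [e_(m+1)].  Were these signs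
    different, the triangle [z], [z + 1], [z + 1 + i] would be cyclic.  So
    [e_m] does not depend on [m], all 1-edges have the same sign, and
    0, 1, ..., n - 1, 0 is a directed cycle, which is absurd
    ([sign1_not_constant]). *)

(** The residue class of [x] modulo [n], as a vertex. *)
Definition vertex {n : nat} (hn : 0 < n) (x : nat) : 'I_n :=
  Ordinal (ltn_pmod x hn).

Lemma ordS_vertex (n : nat) (hn : 0 < n) (x : nat) :
  ordS (vertex hn x) = vertex hn x.+1.
Proof. by apply: val_inj; rewrite /= -addn1 modnDml addn1. Qed.

Lemma vertexDn (n : nat) (hn : 0 < n) (x : nat) :
  vertex hn (x + n) = vertex hn x.
Proof. by apply: val_inj; rewrite /= modnDr. Qed.

Lemma vertex_neq (n : nat) (hn : 0 < n) (x j : nat) :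
  0 < j < n -> vertex hn x != vertex hn (x + j).
Proof.
move=> /andP[j0 jn]; apply/eqP => /(congr1 val) /= /eqP.
by rewrite -{1}(addn0 x) eqn_modDl mod0n modn_small // eq_sym; case: j j0 {jn}.
Qed.

Section Tournament.

Variables (n : nat) (T : {set 'I_n * 'I_n}).
Hypothesis hT : transitive_tournament T.

Lemma tournament_opp x y : x != y -> ((y, x) \in T) = ~~ ((x, y) \in T).
Proof.
case: hT => _ tot _ /tot; by case: ((x, y) \in T); case: ((y, x) \in T).
Qed.

(** Transitivity for the tournament ([b = true]) and its reverse
    ([b = false]) at once. *)
Lemma tournament_trans b x y z : x != y -> y != z -> x != z ->
  ((x, y) \in T) = b -> ((y, z) \in T) = b -> ((x, z) \in T) = b.
Proof.
move=> xy yz xz; case: hT => _ _ tr; case: b => hxy hyz; first exact: tr hxy hyz.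
apply: negbTE; rewrite -tournament_opp //.
by apply: (tr _ y); rewrite tournament_opp ?hxy ?hyz.
Qed.

(** The 1-edges cannot all have the same sign, since then 0, 1, ..., n - 1, 0
    would be a directed cycle. *)
Lemma sign1_not_constant (hn : 0 < n) (b : bool) : 1 < n ->
  ~ (forall x, ((vertex hn x, vertex hn x.+1) \in T) = b).
Proof.
move=> n1 const.
have from0 j : 0 < j < n -> ((vertex hn 0, vertex hn j) \in T) = b.
  elim: j => // -[|j] IH /andP[_ jn]; first exact: const.
  apply: (tournament_trans (y := vertex hn j.+1)) => //.
  - by apply: (vertex_neq hn 0); lia.
  - by rewrite -[j.+2]addn1 vertex_neq.
  - exact: (vertex_neq hn 0).
  - by apply: IH; lia.
have bnd : 0 < n.-1 < n by lia.
have := const n.-1; rewrite prednK // (vertexDn hn 0 : vertex hn n = _).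
rewrite tournament_opp ?from0 ?(vertex_neq hn 0) //.
by case: b {const from0}.
Qed.

End Tournament.

Section Partition.

Variables (n k : nat) (P : 'I_k -> {set {set 'I_n}}).
Hypothesis hP : sigma_partition P.

Lemma label_eq (e : {set 'I_n}) d : e \in P d -> label P e = d.
Proof.
case: hP => injP /and3P[_ triv _] _ ed.
rewrite /label; case: pickP => [d' ed'|/(_ d)]; last by rewrite ed.
have blk (c : 'I_k) : P c \in [set P d | d : 'I_k] by apply: imset_f.
by congr val; apply: injP; rewrite -(def_pblock triv (blk d) ed)
  -(def_pblock triv (blk d') ed').
Qed.

Lemma mem_block (x y : 'I_n) : x != y -> exists d, [set x; y] \in P d.
Proof.
move=> xy; case: hP => _ /and3P[/eqP cov _ _] _.
have : [set x; y] \in complete_graph n by rewrite inE cards2 xy.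
by rewrite -cov => /bigcupP[_ /imsetP[d _ ->] ed]; exists d.
Qed.

Lemma label_lt (x y : 'I_n) : x != y -> label P [set x; y] < k.
Proof. by case/mem_block=> d /label_eq ->. Qed.

(** When the label is [k - 1], the image edge lies in block 0: any block
    [P d] with [0 < d] is the image of [P d.-1]. *)
Lemma label_ordS (x y : 'I_n) : x != y ->
  label P [set ordS x; ordS y] = (label P [set x; y]).+1 %% k.
Proof.
move=> xy; have [d ed] := mem_block xy.
have imS : [set ordS z | z in [set x; y]] = [set ordS x; ordS y].
  by rewrite imsetU1 imset_set1.
have xyS : ordS x != ordS y by rewrite (inj_eq (@ordS_inj n)).
case: (hP) => _ _ shift; rewrite (label_eq ed).
have [dk|dk] := ltnP d.+1 k.
  rewrite modn_small //; apply: (label_eq (d := Ordinal dk)).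
  by rewrite -(shift d (Ordinal dk) erefl) -imS imset_f.
have -> : d.+1 = k by apply/eqP; rewrite eqn_leq dk ltn_ord.
rewrite modnn; have [d' ed'] := mem_block xyS; rewrite (label_eq ed').
case: d' ed' => -[|c] //= ck ed'; exfalso.
have ck' : c < k by apply: ltnW.
move: ed'; rewrite -(shift (Ordinal ck') (Ordinal ck) erefl) => /imsetP[e' e'c].
rewrite -imS => /(imset_inj (@ordS_inj n)) ee; move: e'c.
by rewrite -ee => /label_eq; rewrite (label_eq ed) /=; lia.
Qed.

Section Orientation.

Variable T : {set 'I_n * 'I_n}.
Hypothesis hT : transitive_sigma_orientation P T.

Lemma orientation_ordS (x y : 'I_n) : x != y ->
  (label P [set x; y]).+1 < k -> ((ordS x, ordS y) \in T) = ((x, y) \in T).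
Proof.
case: hT => tour shift xy.
suff imp (u v : 'I_n) : u != v -> (label P [set u; v]).+1 < k ->
    (u, v) \in T -> (ordS u, ordS v) \in T.
  move=> lt; apply/idP/idP; last exact: imp.
  have xyS : ordS x != ordS y by rewrite (inj_eq (@ordS_inj n)).
  apply: contraLR; rewrite -(tournament_opp tour xy) -(tournament_opp tour xyS).
  by apply: imp; rewrite 1?eq_sym // setUC.
move=> uv; have [d ed] := mem_block uv; rewrite (label_eq ed) => dk uvT.
have : (ordS u, ordS v) \in sigma_digraph (oriented_subgraph T (P d)).
  by apply/imsetP; exists (u, v); rewrite // inE uvT.
by rewrite (shift d (Ordinal dk)) // inE => /andP[].
Qed.

Variable hn : 0 < n.

(** The label of the [j]-edge at [x]. *)
Let edge_label x j := label P [set vertex hn x; vertex hn (x + j)].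

(** The sign of the [j]-edge at [x]: whether it is oriented from [x] to
    [x + j]. *)
Let sign x j := (vertex hn x, vertex hn (x + j)) \in T.

Lemma edge_label0 j : 0 < j < n -> edge_label 0 j = defining_sequence P j.
Proof.
move=> /andP[_ jn]; congr (label P _); apply/setP => x.
by rewrite !inE -!val_eqE /= mod0n modn_small.
Qed.

Lemma edge_labelE x j : 0 < j < n ->
  edge_label x j = (defining_sequence P j + x) %% k.
Proof.
move=> jn; elim: x => [|x IH].
  rewrite addn0 -edge_label0 // modn_small //.
  exact/label_lt/vertex_neq.
rewrite /edge_label addSn -!ordS_vertex label_ordS ?vertex_neq //.
by rewrite -/(edge_label x j) IH -addn1 modnDml addn1 addnS.
Qed.

Lemma defining_sequence_lt j : 0 < j < n -> defining_sequence P j < k.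
Proof. by move=> jn; rewrite -edge_label0 //; exact/label_lt/vertex_neq. Qed.

Lemma sign_const x j t : 0 < j < n -> edge_label x j + t < k ->
  sign (x + t) j = sign x j.
Proof.
move=> jn; elim: t => [|t IH] lt; first by rewrite addn0.
have lab : edge_label (x + t) j = edge_label x j + t.
  by rewrite !edge_labelE // addnA -modnDml -edge_labelE // modn_small; lia.
rewrite addnS /sign addSn -!ordS_vertex orientation_ordS.
- by apply: IH; lia.
- exact: vertex_neq.
- by rewrite -/(edge_label (x + t) j) lab -addnS.
Qed.

Lemma edge_label_block m j : 0 < j < n ->
  edge_label (m * k) j = defining_sequence P j.
Proof.
move=> jn; rewrite edge_labelE // addnC modnMDl modn_small //.
exact: defining_sequence_lt.
Qed.

Lemma sign_block m j t : 0 < j < n -> defining_sequence P j + t < k ->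
  sign (m * k + t) j = sign (m * k) j.
Proof. by move=> jn lt; apply: sign_const; rewrite ?edge_label_block. Qed.

(** For every [m], the interval of constant sign around [m * k] starts at
    [m * k - a_j], cut off at 0 since positions are natural numbers. *)
Lemma sign_block_left m j t : 0 < j < n -> t <= defining_sequence P j ->
  t <= m * k -> sign (m * k - t) j = sign (m * k) j.
Proof.
move=> jn tj tm; have ajk := defining_sequence_lt jn.
rewrite -[in RHS](subnK tm) sign_const //.
suff -> : edge_label (m * k - t) j = defining_sequence P j - t by lia.
rewrite edge_labelE // (_ : _ + _ = m * k + (defining_sequence P j - t)).
  by rewrite modnMDl modn_small //; lia.
by lia.
Qed.

(** At a multiple of [k] the shorter edges all follow the 1-edge: as
    [a_j <> k - 1], the [j]-edge keeps its sign from [m * k] to [m * k + 1],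
    where it composes with the 1-edge at [m * k]. *)
Lemma sign_block_start m i j : i.+1 < n ->
  (forall j, 1 <= j <= i -> defining_sequence P j <> k - 1) ->
  0 < j <= i.+1 -> sign (m * k) j = sign (m * k) 1.
Proof.
move=> i_n ha; elim: j => // -[//|j] IH /andP[_ ji].
have [tour _] := hT.
have jn : 0 < j.+1 < n by lia.
have ajk := defining_sequence_lt jn.
have nak : defining_sequence P j.+1 <> k - 1 by apply: ha; lia.
apply: (tournament_trans tour (y := vertex hn (m * k + 1))).
- by apply: vertex_neq; lia.
- by rewrite -[j.+2]add1n addnA vertex_neq.
- by apply: vertex_neq; lia.
- by [].
rewrite -[j.+2]add1n addnA -/(sign _ _) sign_block //; last by lia.
by apply: IH; lia.
Qed.

(** If [a_(i+1) >= a_i + 2], the 1-edges at consecutive multiples of [k] have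
    the same sign, by transitivity on one triangle. *)
Lemma sign_start_const i m : 0 < i -> i.+1 < n ->
  defining_sequence P 1 = 0 ->
  (forall j, 1 <= j <= i -> defining_sequence P j <> k - 1) ->
  defining_sequence P i + 1 < defining_sequence P i.+1 ->
  sign (m.+1 * k) 1 = sign (m * k) 1.
Proof.
move=> i0 i_n a1 ha big; have [tour _] := hT.
have i_bnd : 0 < i < n by lia.
have i1_bnd : 0 < i.+1 < n by lia.
have one_bnd : 0 < 1 < n by lia.
have ak := defining_sequence_lt i1_bnd.
set a := defining_sequence P i in big ak.
(* At z, the (i+1)-edge is already in the block of m + 1, while the 1-edge at z
   and the i-edge at z + 1 are still in that of m. *)
pose z := m * k + (k - a - 2).
have zE : z = m.+1 * k - (a + 2) by rewrite /z mulSn; lia.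
have s1 : sign z 1 = sign (m * k) 1 by apply: sign_block; rewrite ?a1; lia.
have si : sign (z + 1) i = sign (m * k) 1.
  rewrite -addnA sign_block -/a //; last by lia.
  by apply: (sign_block_start m (i := i)) => //; lia.
have si1 : sign z i.+1 = sign (m.+1 * k) 1.
  rewrite zE sign_block_left //; [|by lia|by rewrite mulSn; lia].
  by apply: (sign_block_start m.+1 (i := i)) => //; lia.
rewrite -si1; apply: (tournament_trans tour (y := vertex hn (z + 1))) => //.
- exact: vertex_neq.
- by rewrite -[i.+1]add1n addnA vertex_neq.
- exact: vertex_neq.
- by rewrite -[i.+1]add1n addnA.
Qed.

Lemma defining_sequence_step i : 0 < i -> i.+1 < n ->
  defining_sequence P 1 = 0 ->
  (forall j, 1 <= j <= i -> defining_sequence P j <> k - 1) ->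
  defining_sequence P i.+1 <= defining_sequence P i + 1.
Proof.
move=> i0 i_n a1 ha; rewrite leqNgt; apply/negP => big; have [tour _] := hT.
have one_bnd : 0 < 1 < n by lia.
have k0 : 0 < k by have := defining_sequence_lt one_bnd; lia.
have start m : sign (m * k) 1 = sign 0 1.
  elim: m => [//|m IH]; rewrite -IH.
  exact: (sign_start_const (i := i)).
apply: (sign1_not_constant tour (hn := hn) (b := sign 0 1)) => [|x]; first by lia.
rewrite -[x.+1]addn1 -/(sign x 1) [in LHS](divn_eq x k) -(start (x %/ k)).
by apply: sign_block => //; rewrite a1 ltn_pmod.
Qed.

End Orientation.

End Partition.

Theorem theorem5 (n k : nat) (hn : 1 < n) (hk : 1 < k)
    (P : 'I_k -> {set {set 'I_n}}) (hP : sigma_partition P)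
    (a1 : defining_sequence P 1 = 0)
    (i : nat) (hi : 1 <= i < n./2)
    (ha : forall j : nat, 1 <= j <= i -> defining_sequence P j <> k - 1)
    (hT : exists T : {set 'I_n * 'I_n}, transitive_sigma_orientation P T) :
  defining_sequence P i.+1 <= defining_sequence P i + 1.
Proof.
have [T hT'] := hT; have n0 : 0 < n by apply: ltnW.
by apply: (defining_sequence_step hP hT' n0) => //; lia.
Qed.
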